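(* Let $n,k\ge 0$ and let ${\cal M}_R(m,t;n+k,n)$ be the set of all $(m,t)$-subspaces of $R^{n+k}$. Then ${\cal M}_R(m,t;n+k,n)$ is non-empty if and only if $0\leq t\leq k$ and $0\leq m-t\leq n$. Moreover, if it is non-empty, then it forms a single orbit of subspaces under the action of $GL_{n+k,n}(R)$, and $$N_R(m,t;n+k,n):=|{\cal M}_R(m,t;n+k,n)|=|R|^{(m-t)(k-t)}N_R(m-t,n)N_R(t,k),$$ where $N_R(a,b)=\prod_{j=1}^{\ell}\prod_{i=0}^{a-1}\frac{|R_j|^{b-i}-|M_j|^{b-i}}{|R_j|^{a-i}-|M_j|^{a-i}}$ is the number of $a$-subspaces of $R^b$.
   Context: $R$ is a finite commutative ring with identity $1\neq 0$, written as a direct product $R=R_1\times\cdots\times R_\ell$ of finite local rings $R_j$ with maximal ideals $M_j$. $R^{N}$ denotes row vectors of length $N$ over $R$. A set $\{\alpha_1,\dots,\alpha_m\}\subseteq R^N$ is unimodular if the matrix with rows $\alpha_i$ has a right inverse. An $m$-subspace of $R^N$ is an $R$-submodule having a basis of $m$ vectors forming a unimodular set; the $0$-subspace is $\{0\}$. $GL_{n+k,n}(R)$ is the group of invertible $(n+k)\times(n+k)$ matrices of the form $\begin{pmatrix}T_{11}&T_{12}\\0&T_{22}\end{pmatrix}$ with $T_{11}\in GL_n(R)$, $T_{22}\in GL_k(R)$, acting on subspaces $P$ of $R^{n+k}$ by $P\mapsto PT$. Let $e_i$ be the $i$-th standard unit row vector of $R^{n+k}$ and $E=\langle e_{n+1},\dots,e_{n+k}\rangle$.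 An $m$-subspace $P$ of $R^{n+k}$ is an $(m,t)$-subspace if $P\cap E$ is a $t$-subspace. *)

(* Defs.v *)
From HB Require Import structures.
From mathcomp Require Import all_boot all_order all_algebra.

Set Implicit Arguments.
Unset Strict Implicit.
Unset Printing Implicit Defensive.

Import GRing.Theory.
Local Open Scope ring_scope.

(* [idealr_closed] includes properness ([1 \notin I]). *)
Definition maximal_ideal (S : finComNzRingType) (M : {set S}) : Prop :=
  idealr_closed M /\
  forall I : {set S}, idealr_closed I -> M \subset I -> I = M.

Definition local_ring (S : finComNzRingType) (M : {set S}) : Prop :=
  maximal_ideal M /\ forall I : {set S}, maximal_ideal I -> I = M.

(* The ring R is the direct product of the rings S j, with projections proj j:
   the ring morphism x |-> (proj j x)_j is a bijection onto the product. *)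
Definition is_ring_product (R : finComNzRingType) (l : nat)
    (S : 'I_l -> finComNzRingType) (proj : forall j, {rmorphism R -> S j}) : Prop :=
  bijective (fun x : R => [ffun j : 'I_l => proj j x] : {dffun forall j, S j}).

Section Subspaces.
Variable R : finComNzRingType.

(* Finite families of vectors of R^N are the rows of a matrix. *)
Definition unimodular (m N : nat) (A : 'M[R]_(m, N)) : bool :=
  [exists B : 'M[R]_(N, m), A *m B == 1%:M].

Definition rowspan (m N : nat) (A : 'M[R]_(m, N)) : {set 'rV[R]_N} :=
  [set x *m A | x : 'rV[R]_m].

Definition lin_indep (m N : nat) (A : 'M[R]_(m, N)) : bool :=
  [forall x : 'rV[R]_m, (x *m A == 0) ==> (x == 0)].

Definition is_basis (m N : nat) (P : {set 'rV[R]_N}) (A : 'M[R]_(m, N)) : bool :=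
  lin_indep A && (P == rowspan A).

(* For m = 0 the basis is empty and the only 0-subspace is {0}. *)
Definition is_subspace (m N : nat) (P : {set 'rV[R]_N}) : bool :=
  [exists A : 'M[R]_(m, N), is_basis P A && unimodular A].

Definition subspaces (m N : nat) : {set {set 'rV[R]_N}} :=
  [set P | is_subspace m P].

Definition unit_row (N : nat) (i : 'I_N) : 'rV[R]_N := delta_mx 0 i.

(* [rshift n i] is the index n + i, for i < k. *)
Definition E_space (n k : nat) : {set 'rV[R]_(n + k)} :=
  rowspan (\matrix_(i < k) unit_row (rshift n i)).

Definition is_mt_subspace (n k m t : nat) (P : {set 'rV[R]_(n + k)}) : bool :=
  is_subspace m P && is_subspace t (P :&: E_space n k).

Definition mt_subspaces (n k m t : nat) : {set {set 'rV[R]_(n + k)}} :=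
  [set P | is_mt_subspace m t P].

(* [unitmx] would require R to carry a unitRingType structure. *)
Definition invertible_mx (N : nat) (T : 'M[R]_N) : bool :=
  [exists U : 'M[R]_N, (T *m U == 1%:M) && (U *m T == 1%:M)].

Definition GL_block (n k : nat) : {set 'M[R]_(n + k)} :=
  [set T | invertible_mx T &&
    [exists T11 : 'M[R]_n, exists T12 : 'M[R]_(n, k), exists T22 : 'M[R]_k,
       [&& invertible_mx T11, invertible_mx T22
         & T == block_mx T11 T12 0 T22]]].

Definition subspace_act (N : nat) (P : {set 'rV[R]_N}) (T : 'M[R]_N) :
    {set 'rV[R]_N} := [set v *m T | v in P].

Definition GL_orbit (n k : nat) (P : {set 'rV[R]_(n + k)}) :
    {set {set 'rV[R]_(n + k)}} :=
  [set subspace_act P T | T in GL_block n k].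

End Subspaces.

(* N_R(a, b). The natural-number subtraction b - i is only truncated when
   a > b; the factor for i = b is then 0, so the product vanishes. *)
Definition subspace_count (l : nat) (S : 'I_l -> finComNzRingType)
    (M : forall j, {set S j}) (a b : nat) : rat :=
  \prod_(j < l) \prod_(i < a)
    ((#|S j|%:R ^+ (b - i)%N - #|M j|%:R ^+ (b - i)%N) /
     (#|S j|%:R ^+ (a - i)%N - #|M j|%:R ^+ (a - i)%N)).

(* Main.v *)
(** Over a finite commutative ring a matrix with linearly independent rows can be
    brought to the form (1 0) by an invertible column operation: a row with zero
    annihilator generates the unit ideal, and stable rank one moves it to
    (1, 0, ..., 0). So linearly independent rows are unimodular, and any two
    such matrices of the same size are related by an invertible matrix on the
    right. Consequently every (m,t)-subspace is the row span of a matrix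
    (0 Z; Y X) with Z of size t x k and Y of size (m-t) x n both having
    independent rows, and X arbitrary; an explicit block triangular matrix maps
    one such matrix to another, whence the single orbit.

    All cardinalities come from counting matrices with independent rows and
    dividing by the size of the fibres of the row span map, on which invertible
    (block triangular) matrices act simply transitively on the left. The matrices
    themselves are counted row by row, which reduces to single rows of length c;
    in the product of the local rings R_j there are
    prod_j (|R_j|^c - |M_j|^c) of these, since a row is independent iff in each
    component some entry avoids M_j. *)

Require Import Defs.
From mathcomp Require Import all_boot all_order all_algebra.
From mathcomp Require Import ring zify.
Import GRing.Theory Num.Theory.
Local Open Scope ring_scope.

Set Implicit Arguments.
Unset Strict Implicit.
Unset Printing Implicit Defensive.

(** * Idempotent powers and stable rank one in finite commutative rings *)

(** By pigeonhole [a ^+ i = a ^+ j] with 0 < i < j, so the powers are periodic from i on; the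
    exponent i (j - i) is a multiple of the period and at least i. *)
Lemma idempotent_power (R : finComNzRingType) (a : R) :
  exists K, a ^+ K.+1 * a ^+ K.+1 = a ^+ K.+1.
Proof.
have [i [j [i0 ltij eqij]]] :
    exists i j : nat, [/\ (0 < i)%N, (i < j)%N & a ^+ i = a ^+ j].
  have /injectivePn[x [y nexy exy]] :
      ~~ injectiveb (fun i : 'I_#|R|.+1 => a ^+ i.+1).
    by apply/negP => /injectiveP/leq_card; rewrite card_ord ltnn.
  have nxy : (x : nat) != y by [].
  by move: nxy; rewrite neq_ltn => /orP[] lxy; [exists x.+1, y.+1 | exists y.+1, x.+1].
have periodic n q : (i <= n)%N -> a ^+ (n + q * (j - i)) = a ^+ n.
  move=> lein; elim: q => [|q IHq]; first by rewrite addn0.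
  have -> : (n + q.+1 * (j - i) = n - i + q * (j - i) + j)%N by lia.
  by rewrite exprD -eqij -exprD addnAC subnK.
exists (i * (j - i)).-1; rewrite prednK ?muln_gt0 ?i0 ?subn_gt0 //.
by rewrite -exprD periodic // leq_pmulr // subn_gt0.
Qed.

(** Multiplication by [u] is injective on a finite set, hence surjective, so 1 is attained. *)
Lemma regular_invertible (R : finComNzRingType) (u : R) :
  (forall z, u * z = 0 -> z = 0) -> exists w, u * w = 1.
Proof.
move=> reg; have inj : injective (fun z => u * z).
  move=> x y /eqP; rewrite -subr_eq0 -mulrBr => /eqP/reg/eqP.
  by rewrite subr_eq0 => /eqP.
by have [g _ gK] := injF_bij inj; exists (g 1).
Qed.

(* Let e be an idempotent power of a. On the ideal (e) the element a is
   invertible; on (1 - e) it is nilpotent, so that b is invertible there.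
   Hence a + b (1 - e) is invertible. *)
Lemma stable_rank_one (R : finComNzRingType) (a b x y : R) :
  a * x + b * y = 1 -> exists c w, (a + b * c) * w = 1.
Proof.
move=> eq1; have [K idK] := idempotent_power a.
exists (1 - a ^+ K.+1); apply: regular_invertible => z zero.
have ez0 : a ^+ K.+1 * z = 0.
  (* Multiplying [zero] by e removes the b term, since e (1 - e) = 0. *)
  have aez : a * (a ^+ K.+1 * z) = 0.
    transitivity (a ^+ K.+1 * ((a + b * (1 - a ^+ K.+1)) * z)
       + b * z * (a ^+ K.+1 * a ^+ K.+1 - a ^+ K.+1)); first by ring.
    by rewrite zero idK subrr !mulr0 addr0.
  by rewrite -idK {1}exprSr -!mulrA aez mulr0.
have abz : (a + b) * z = 0.
  transitivity ((a + b * (1 - a ^+ K.+1)) * z + b * (a ^+ K.+1 * z)); first by ring.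
  by rewrite zero ez0 mulr0 addr0.
(* Put b z = - a z into (a x + b y) z = z. Iterating makes z a multiple of e z = 0. *)
have zE : z = a * (x - y) * z.
  transitivity ((a * x + b * y) * z - y * ((a + b) * z)); last by ring.
  by rewrite eq1 abz mulr0 subr0 mul1r.
have iterz q : z = a ^+ q * (x - y) ^+ q * z.
  elim: q => [|q IHq]; first by rewrite !expr0 !mul1r.
  by rewrite {1}IHq {1}zE !exprSr; ring.
by rewrite (iterz K.+1) mulrAC ez0 mul0r.
Qed.

(** * Linear independence and invertible matrices *)

Lemma lin_indepP (R : finComNzRingType) m N (A : 'M[R]_(m, N)) :
  reflect (forall x : 'rV_m, x *m A = 0 -> x = 0) (lin_indep A).
Proof.
apply: (iffP forallP) => [h x /eqP xA0 | h x]; first by apply/eqP/(implyP (h x)).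
by apply/implyP => /eqP/h ->.
Qed.

Lemma lin_indep_mulIr (R : finComNzRingType) m p N (A : 'M[R]_(m, N)) :
  lin_indep A -> injective (fun X : 'M_(p, m) => X *m A).
Proof.
move/lin_indepP=> hA X Y eqXY; apply/row_matrixP => i.
apply/eqP; rewrite -subr_eq0; apply/eqP/hA.
by rewrite mulmxBl -!row_mul eqXY subrr.
Qed.

Lemma rowspanP (R : finComNzRingType) m N (A : 'M[R]_(m, N)) v :
  reflect (exists x, v = x *m A) (v \in rowspan A).
Proof. by apply: (iffP imsetP) => [[x _ ->]|[x ->]]; exists x. Qed.

Lemma invertible_mxP (R : finComNzRingType) N (T : 'M[R]_N) :
  reflect (exists2 U, T *m U = 1%:M & U *m T = 1%:M) (invertible_mx T).
Proof.
apply: (iffP existsP) => [[U /andP[/eqP TU /eqP UT]]|[U TU UT]]; first by exists U.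
by exists U; rewrite TU UT !eqxx.
Qed.

Lemma invertible_mxM (R : finComNzRingType) N (A B : 'M[R]_N) :
  invertible_mx A -> invertible_mx B -> invertible_mx (A *m B).
Proof.
move=> /invertible_mxP[A' AA' A'A] /invertible_mxP[B' BB' B'B].
apply/invertible_mxP; exists (B' *m A').
  by rewrite mulmxA -(mulmxA A) BB' mulmx1.
by rewrite mulmxA -(mulmxA B') A'A mulmx1.
Qed.

Lemma invertible_mx_right (R : finComNzRingType) N (A B : 'M[R]_N) :
  A *m B = 1%:M -> invertible_mx A.
Proof. by move=> AB; apply/invertible_mxP; exists B => //; apply: mulmx1C. Qed.

Lemma invertible_block_ut (R : finComNzRingType) n k (A : 'M[R]_n)
    (B : 'M[R]_(n, k)) (D : 'M[R]_k) :
  invertible_mx A -> invertible_mx D -> invertible_mx (block_mx A B 0 D).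
Proof.
move=> /invertible_mxP[A' AA' _] /invertible_mxP[D' DD' _].
apply: (@invertible_mx_right _ _ _ (block_mx A' (- (A' *m B *m D')) 0 D')).
rewrite mulmx_block !mulmx0 !mul0mx !addr0 !add0r AA' DD' mulmxN !mulmxA AA'.
by rewrite mul1mx addNr -scalar_mx_block.
Qed.

Lemma invertible_block_lt (R : finComNzRingType) n k (A : 'M[R]_n)
    (C : 'M[R]_(k, n)) (D : 'M[R]_k) :
  invertible_mx A -> invertible_mx D -> invertible_mx (block_mx A 0 C D).
Proof.
move=> /invertible_mxP[A' AA' _] /invertible_mxP[D' DD' _].
apply: (@invertible_mx_right _ _ _ (block_mx A' 0 (- (D' *m C *m A')) D')).
rewrite mulmx_block !mulmx0 !mul0mx !addr0 !add0r AA' DD' mulmxN !mulmxA DD'.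
by rewrite mul1mx addrN -scalar_mx_block.
Qed.

Lemma invertible_mx1 (R : finComNzRingType) N : invertible_mx (1%:M : 'M[R]_N).
Proof. by apply: (@invertible_mx_right _ _ _ 1%:M); rewrite mulmx1. Qed.

Lemma lin_indep_mulr (R : finComNzRingType) m N (A : 'M[R]_(m, N)) (G : 'M_N) :
  invertible_mx G -> lin_indep A -> lin_indep (A *m G).
Proof.
move=> /invertible_mxP[G' GG' _] /lin_indepP hA; apply/lin_indepP => x xAG.
by apply: hA; rewrite -[x *m A]mulmx1 -GG' mulmxA -(mulmxA x) xAG mul0mx.
Qed.

Lemma unimodular_lin_indep (R : finComNzRingType) m N (A : 'M[R]_(m, N)) B :
  A *m B = 1%:M -> lin_indep A.
Proof.
move=> AB; apply/lin_indepP => x xA0.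
by rewrite -[x]mulmx1 -AB mulmxA xA0 mul0mx.
Qed.

(** * Column reduction of independent rows *)

(* With e an idempotent power of the first entry a, either z (1 - e) lies in the
   ideal of the other entries, and then z is in the ideal of all of them, or
   some nonzero y in (z (1 - e)) is killed by the others; a acts nilpotently
   on y, so the last nonzero a^r y is killed by everything. *)
Lemma annihilator_or_ideal (R : finComNzRingType) N (v : 'rV[R]_N) (z : R) :
  (exists2 y, y != 0 & (exists c, y = z * c) /\ y *: v = 0) \/
  (exists c : 'cV_N, v *m c = z%:M).
Proof.
elim: N v z => [|N IHN] v z.
  have [->|z0] := eqVneq z 0.
    by right; exists 0; rewrite mulmx0; apply/matrixP=> i j; rewrite !mxE mul0rn.
  left; exists z => //; split; first by exists 1; rewrite mulr1.
  by rewrite [v]thinmx0 scaler0.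
rewrite -[N.+1]/(1 + N)%N in v *; rewrite -[v]hsubmxK [lsubmx v]mx11_scalar.
set a := lsubmx v 0 0; set b := rsubmx v.
have [K idK] := idempotent_power a.
(* The induction hypothesis is needed at z (1 - e), hence the arbitrary z in the statement. *)
case: (IHN b (z * (1 - a ^+ K.+1))) => [[y y0 [[c yE] yb]]|[c bc]]; last first.
  right; exists (col_mx (z * a ^+ K)%:M c).
  rewrite mul_row_col bc -scalar_mxM -raddfD /=; congr (_%:M).
  by rewrite exprS; ring.
left; have nil : a ^+ K.+1 * y = 0.
  rewrite yE; transitivity (z * c * (a ^+ K.+1 - a ^+ K.+1 * a ^+ K.+1)); first by ring.
  by rewrite idK subrr mulr0.
have ex : exists r, a ^+ r * y == 0 by exists K.+1; rewrite nil.
case: (ex_minnP ex) => -[|r] /eqP ary min.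
  by move: y0; rewrite -[y]mul1r ary eqxx.
exists (a ^+ r * y).
  by apply/negP => /min; rewrite ltnn.
split; first by exists ((1 - a ^+ K.+1) * c * a ^+ r); rewrite yE; ring.
rewrite scale_row_mx scale_scalar_mx -scalerA yb scaler0 mulrC mulrA -exprS ary.
by rewrite raddf0 row_mx0.
Qed.

Lemma lin_indep_row_reduce (R : finComNzRingType) N (v : 'rV[R]_(1 + N)) :
  lin_indep v -> exists2 G, invertible_mx G & v *m G = row_mx 1%:M 0.
Proof.
move=> /lin_indepP hv.
have [w vw] : exists w : 'cV_(1 + N), v *m w = 1%:M.
  case: (annihilator_or_ideal v 1) => [[y y0 [_ yv]]|//].
  have /hv/matrixP/(_ 0 0) : y%:M *m v = 0 by rewrite mul_scalar_mx.
  by rewrite !mxE => /eqP; rewrite mulr1n (negbTE y0).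
move: vw; rewrite -[w]vsubmxK -[v]hsubmxK mul_row_col.
set a := lsubmx v; set b := rsubmx v; set x := usubmx w; set y := dsubmx w => eq1.
(* The product b y is treated as one ring element with coefficient 1, so the two-term statement of
   stable rank one applies. *)
have eq1' : a 0 0 * x 0 0 + (b *m y) 0 0 * 1 = 1.
  move/matrixP/(_ 0 0): eq1; rewrite {1}[a]mx11_scalar mul_scalar_mx.
  by rewrite [LHS]mxE [(_ *: x) 0 0]mxE [RHS]mxE mulr1 [in RHS]eqxx.
have [c [u uE]] := stable_rank_one eq1'.
set d := _ + _ in uE.
have dE : a + b *m (c *: y) = d%:M.
  by rewrite [LHS]mx11_scalar -scalemxAr mxE [(c *: (b *m y)) 0 0]mxE mulrC.
(* The first factor turns the leading entry into the unit d; the second scales it by its inverse u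
   and clears b. *)
exists (block_mx 1%:M 0 (c *: y) 1%:M *m block_mx u%:M (- (u *: b)) 0 1%:M).
  apply: invertible_mxM.
    by apply: invertible_block_lt; apply: invertible_mx1.
  apply: invertible_block_ut; last exact: invertible_mx1.
  by apply: (@invertible_mx_right _ _ _ d%:M); rewrite -scalar_mxM mulrC uE.
rewrite mulmxA !mul_row_block !mulmx0 !mulmx1 !addr0 !add0r dE -scalar_mxM uE.
by rewrite mul_scalar_mx scalerN scalerA uE scale1r addNr.
Qed.

Lemma pid_mx_Sblock (R : finComNzRingType) t N :
  pid_mx t.+1 = block_mx 1%:M 0 0 (pid_mx t) :> 'M[R]_(1 + t, 1 + N).
Proof.
apply/matrixP => i j; rewrite !mxE.
case: (splitP i) => i' ->; rewrite !mxE; case: (splitP j) => j' ->;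
  rewrite !mxE ?(ord1 i') ?(ord1 j') //=.
Qed.

(** Induction on the rows: make the first row (1 0), reduce the lower right block, then clear the
    column below the 1. *)
Lemma lin_indep_reduce (R : finComNzRingType) t N (A : 'M[R]_(t, N)) :
  lin_indep A -> (t <= N)%N /\ exists2 G, invertible_mx G & A *m G = pid_mx t.
Proof.
elim: t N A => [|t IHt] N A hA.
  split=> //; exists 1%:M; first exact: invertible_mx1.
  by rewrite [A]flatmx0 [RHS]flatmx0 mul0mx.
rewrite -[t.+1]/(1 + t)%N in A hA *.
case: N A hA => [|N] A hA.
  (* Without columns the row of ones is a relation, and it is nonzero because 1 is not 0. *)
  move/lin_indepP: hA => /(_ (const_mx 1)).
  rewrite [A]thinmx0 mulmx0 => /(_ erefl)/matrixP/(_ 0 0).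
  by rewrite !mxE => /eqP; rewrite oner_eq0.
rewrite -[N.+1]/(1 + N)%N in A hA *.
have hv : lin_indep (usubmx A).
  apply/lin_indepP => x xv; move/lin_indepP: hA => /(_ (row_mx x 0)).
  rewrite -[A]vsubmxK mul_row_col xv mul0mx addr0 => /(_ erefl)/eqP.
  by rewrite row_mx_eq0 => /andP[/eqP].
have [G1 invG1 vG1] := lin_indep_row_reduce hv.
have hAG := lin_indep_mulr invG1 hA.
have := erefl (A *m G1); rewrite -{2}[A]vsubmxK mul_col_mx vG1.
set A' := dsubmx A *m G1; rewrite -[A']hsubmxK.
set C := lsubmx A'; set D := rsubmx A' => AG1.
(* A relation x of [D] lifts to the relation (- x C, x) of [A *m G1]. *)
have hD : lin_indep D.
  apply/lin_indepP => x xD; move/lin_indepP: hAG => /(_ (row_mx (- (x *m C)) x)).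
  rewrite AG1 mul_row_col !mul_mx_row mulmx1 mulmx0 xD add_row_mx.
  rewrite addNr addr0 row_mx0 => /(_ erefl)/eqP.
  by rewrite row_mx_eq0 => /andP[_ /eqP].
have [leN [G2 invG2 DG2]] := IHt _ _ hD.
split=> //.
exists (G1 *m block_mx 1%:M 0 0 G2 *m block_mx 1%:M 0 (- (pid_mx t *m C)) 1%:M).
  apply: invertible_mxM; last first.
    by apply: invertible_block_lt; apply: invertible_mx1.
  apply: invertible_mxM => //.
  by apply: invertible_block_lt => //; apply: invertible_mx1.
rewrite !mulmxA AG1 -block_mxEv !mulmx_block !mulmx0 !mul0mx !mulmx1 !addr0 !add0r.
rewrite DG2 !mulmxN mul0mx subr0 mulmxA mul_pid_mx minnn (minn_idPr leN) pid_mx_1 mul1mx addrN.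
by rewrite -pid_mx_Sblock.
Qed.

Lemma lin_indep_right_inverse (R : finComNzRingType) m N (A : 'M[R]_(m, N)) :
  lin_indep A -> exists B, A *m B = 1%:M.
Proof.
move=> /lin_indep_reduce[lemN [G _ AG]]; exists (G *m pid_mx m).
by rewrite mulmxA AG mul_pid_mx minnn (minn_idPr lemN) pid_mx_1.
Qed.

(** * Subspaces as row spans *)

Lemma is_subspaceP (R : finComNzRingType) m N (P : {set 'rV[R]_N}) :
  reflect (exists2 A : 'M[R]_(m, N), lin_indep A & P = rowspan A)
          (is_subspace m P).
Proof.
apply: (iffP existsP) => [[A /andP[/andP[hA /eqP PA] _]]|[A hA PA]].
  by exists A.
exists A; rewrite /is_basis hA PA eqxx /=; apply/existsP.
by have [B /eqP AB] := lin_indep_right_inverse hA; exists B.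
Qed.

Lemma lin_indep_invertible (R : finComNzRingType) m (G : 'M[R]_m) :
  lin_indep G = invertible_mx G.
Proof.
apply/idP/idP => [/lin_indep_right_inverse[B]|/invertible_mxP[B]].
  exact: invertible_mx_right.
by move=> GB _; apply: unimodular_lin_indep GB.
Qed.

Lemma lin_indep_mull (R : finComNzRingType) m p N (X : 'M[R]_(p, m))
    (A : 'M[R]_(m, N)) :
  lin_indep A -> lin_indep (X *m A) = lin_indep X.
Proof.
move=> /lin_indepP hA; apply/lin_indepP/lin_indepP => hX x.
  by move=> xX; apply: hX; rewrite mulmxA xX mul0mx.
by rewrite mulmxA => /hA/hX.
Qed.

Lemma lin_indep_mulmxr (R : finComNzRingType) m N (A : 'M[R]_(m, N)) (G : 'M_N) :
  invertible_mx G -> lin_indep (A *m G) = lin_indep A.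
Proof. by rewrite -lin_indep_invertible => /lin_indep_mull ->. Qed.

Lemma rowspan_mull (R : finComNzRingType) m N (G : 'M[R]_m) (A : 'M[R]_(m, N)) :
  lin_indep G -> rowspan (G *m A) = rowspan A.
Proof.
rewrite lin_indep_invertible => /invertible_mxP[H _ HG].
apply/setP => v; apply/rowspanP/rowspanP => [[x ->]|[x ->]].
  by exists (x *m G); rewrite mulmxA.
by exists (x *m H); rewrite mulmxA -(mulmxA x) HG mulmx1.
Qed.

Lemma rowspan_subP (R : finComNzRingType) p m N (B : 'M[R]_(p, N))
    (A : 'M[R]_(m, N)) :
  rowspan B \subset rowspan A -> exists X, B = X *m A.
Proof.
move=> sBA; have rowB i : exists x, row i B == x *m A.
  have /(subsetP sBA)/rowspanP[x eqx] : row i B \in rowspan B.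
    by apply/rowspanP; exists (delta_mx 0 i); rewrite rowE.
  by exists x; apply/eqP.
exists (\matrix_i xchoose (rowB i)); apply/row_matrixP => i.
by rewrite row_mul rowK; apply/eqP/(xchooseP (rowB i)).
Qed.

(** * Counting independent rows and subspaces *)

Lemma card_fibres (T U : finType) (f : T -> U) (D : {set T}) (E : {set U}) c :
  {in D, forall x, f x \in E} ->
  {in E, forall y, #|[set x in D | f x == y]| = c} -> #|D| = (#|E| * c)%N.
Proof.
move=> fDE fib; rewrite -sum1_card (partition_big f (mem E)) //=.
rewrite -sum_nat_const; apply: eq_bigr => y /fib <-.
by rewrite -sum1_card; apply: eq_bigl => x; rewrite inE.
Qed.

Definition free_mx (R : finComNzRingType) (m N : nat) : {set 'M[R]_(m, N)} :=
  [set A | lin_indep A].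

Lemma card_mx_set (R : finComNzRingType) m n :
  #|[set: 'M[R]_(m, n)]| = (#|R| ^ (m * n))%N.
Proof. by rewrite cardsT card_mx. Qed.

(** The rows (1 0) can absorb the left block of [w], so only its right block matters. *)
Lemma lin_indep_col_row1 (R : finComNzRingType) m a c (w : 'M[R]_(m, a + c)) :
  lin_indep (col_mx w (row_mx 1%:M 0 : 'M_(a, a + c))) = lin_indep (rsubmx w).
Proof.
rewrite -{1}[w]hsubmxK; apply/lin_indepP/lin_indepP => h x.
  move=> xw; have := h (row_mx x (- (x *m lsubmx w))).
  rewrite mul_row_col !mul_mx_row xw mulmx1 mulmx0 add_row_mx addrN addr0 row_mx0.
  by move=> /(_ erefl)/eqP; rewrite row_mx_eq0 => /andP[/eqP].
rewrite -[x]hsubmxK mul_row_col !mul_mx_row mulmx1 mulmx0 add_row_mx addr0.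
move/eqP; rewrite row_mx_eq0 => /andP[/eqP e1 /eqP/h x0].
by move: e1; rewrite x0 mul0mx add0r => ->; rewrite row_mx0.
Qed.

(** Once the last [a] rows are brought to (1 0), a row (w1 w2) may be put on top exactly when w2 is
    independent, with w1 free. *)
Lemma card_free_mxS (R : finComNzRingType) a b :
  #|free_mx R a.+1 b| =
    (#|free_mx R a b| * (#|R| ^ a * #|free_mx R 1 (b - a)|))%N.
Proof.
have [leab|ltba] := leqP a b; last first.
  have empty a' : (b < a')%N -> #|free_mx R a' b| = 0%N.
    move=> ltb; apply: eq_card0 => A; rewrite inE.
    by apply/negP => /lin_indep_reduce[]; rewrite leqNgt ltb.
  by rewrite !empty // ltnW.
rewrite -(subnKC leab) addKn; set c := (b - a)%N.
rewrite -[a.+1]/(1 + a)%N.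
apply: (@card_fibres _ _ (fun X : 'M_(1 + a, a + c) => dsubmx X)) => [X|A].
  rewrite !inE => /lin_indepP hX; apply/lin_indepP => x xX.
  have := hX (row_mx 0 x); rewrite -[X]vsubmxK mul_row_col xX mul0mx addr0.
  by move=> /(_ erefl)/eqP; rewrite row_mx_eq0 => /andP[_ /eqP].
rewrite inE => /lin_indep_reduce[_ [G invG]]; rewrite pid_mx_row => AG.
have [H GH HG] := invertible_mxP _ invG.
have invH : invertible_mx H by apply: invertible_mx_right HG.
pose g (p : 'rV[R]_a * 'rV[R]_c) := col_mx (row_mx p.1 p.2 *m H) A.
rewrite -[a in (_ ^ a)%N]mul1n -card_mx_set -cardsX.
rewrite -(@card_in_imset _ _ g).
  apply: eq_card => X; apply/idP/imsetP => [|[[w1 w2]]]; last first.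
    rewrite !inE /= => hw2 ->; rewrite /g /= col_mxKd eqxx andbT.
    by rewrite -(lin_indep_mulmxr _ invG) mul_col_mx AG -mulmxA HG mulmx1
      lin_indep_col_row1 row_mxKr.
  rewrite !inE => /andP[hX /eqP dX].
  exists (lsubmx (usubmx X *m G), rsubmx (usubmx X *m G)).
    rewrite !inE /= -lin_indep_col_row1 -AG -mul_col_mx lin_indep_mulmxr //.
    by rewrite -dX vsubmxK.
  by rewrite /g /= hsubmxK -mulmxA GH mulmx1 -dX vsubmxK.
move=> [w1 w2] [w1' w2'] _ _ /eq_col_mx[/(congr1 (mulmx^~ G))].
by rewrite -!mulmxA HG !mulmx1 => /eq_row_mx[/= -> ->].
Qed.

Lemma card_free_mx (R : finComNzRingType) a b :
  #|free_mx R a b| = (\prod_(i < a) (#|R| ^ i * #|free_mx R 1 (b - i)|))%N.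
Proof.
elim: a => [|a IHa]; last by rewrite big_ord_recr /= -IHa card_free_mxS.
rewrite big_ord0; apply/eqP/cards1P; exists 0; apply/setP => A.
rewrite !inE [A]flatmx0 eqxx; apply/lin_indepP => x _; exact: thinmx0.
Qed.

Lemma free_mx_square_gt0 (R : finComNzRingType) a : (0 < #|free_mx R a a|)%N.
Proof.
rewrite (cardD1 1%:M) inE; apply: leq_trans (leq_addr _ _).
by rewrite lin_indep_invertible invertible_mx1.
Qed.

(** The bases of the span of [A] are the products [G *m A] with [G] invertible, each from a unique
    [G]. *)
Lemma card_subspaces_free (R : finComNzRingType) a b :
  #|free_mx R a b| = (#|subspaces R a b| * #|free_mx R a a|)%N.
Proof.
apply: (@card_fibres _ _ (@rowspan R a b)) => [A|P].
  by rewrite !inE => hA; apply/is_subspaceP; exists A.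
rewrite inE => /is_subspaceP[A hA ->].
rewrite -(card_imset _ (@lin_indep_mulIr _ _ a _ _ hA)); apply: eq_card => B.
apply/idP/imsetP => [|[G]]; rewrite !inE.
  move=> /andP[hB /eqP eqBA]; have [|G BG] := @rowspan_subP _ _ _ _ B A.
    by rewrite eqBA.
  by exists G => //; rewrite inE -(lin_indep_mull G hA) -BG.
by move=> hG ->; rewrite rowspan_mull // eqxx lin_indep_mull ?hG.
Qed.

(** * Normal form and number of (m,t)-subspaces *)

Lemma E_spaceE (R : finComNzRingType) n k (v : 'rV[R]_(n + k)) :
  (v \in E_space R n k) = (lsubmx v == 0).
Proof.
have -> : E_space R n k = rowspan (row_mx 0 1%:M).
  congr (rowspan _); apply/matrixP => i j; rewrite !mxE eqxx /=.
  case: (splitP j) => j' ej; rewrite !mxE -val_eqE /= ej.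
    by rewrite ltn_eqF // (leq_trans (ltn_ord _)) ?leq_addr.
  by rewrite eqn_add2l eq_sym.
apply/rowspanP/eqP => [[x ->]|v0].
  by rewrite mul_mx_row mulmx0 row_mxKl.
by exists (rsubmx v); rewrite mul_mx_row mulmx0 mulmx1 -v0 hsubmxK.
Qed.

Section NormalForm.
Variables (R : finComNzRingType) (n k t s : nat).
Implicit Types (Z : 'M[R]_(t, k)) (Y : 'M[R]_(s, n)) (X : 'M[R]_(s, k)).

(** The first [t] rows lie in E; if [Y] has independent rows, no combination involving the last [s]
    rows does. *)
Definition mt_basis Z Y X : 'M[R]_(t + s, n + k) := block_mx 0 Z Y X.

Lemma mul_row_mt_basis p Z Y X (x : 'M[R]_(p, t)) (y : 'M[R]_(p, s)) :
  row_mx x y *m mt_basis Z Y X = row_mx (y *m Y) (x *m Z + y *m X).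
Proof. by rewrite mul_row_block mulmx0 add0r. Qed.

Lemma lin_indep_mt_basis Z Y X :
  lin_indep Z -> lin_indep Y -> lin_indep (mt_basis Z Y X).
Proof.
move=> /lin_indepP hZ /lin_indepP hY; apply/lin_indepP => x.
rewrite -[x]hsubmxK mul_row_mt_basis => /eqP; rewrite row_mx_eq0.
move=> /andP[/eqP/hY -> /eqP]; rewrite mul0mx addr0 => /hZ ->.
by rewrite row_mx0.
Qed.

Lemma mt_basis_mt_subspace Z Y X :
  lin_indep Z -> lin_indep Y ->
  rowspan (mt_basis Z Y X) \in mt_subspaces R n k (t + s) t.
Proof.
move=> hZ hY; rewrite inE; apply/andP; split; apply/is_subspaceP.
  by exists (mt_basis Z Y X) => //; apply: lin_indep_mt_basis.
exists (row_mx 0 Z).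
  apply/lin_indepP => x; rewrite mul_mx_row => /eqP; rewrite row_mx_eq0.
  by case/andP=> _ /eqP; move/lin_indepP: hZ; apply.
apply/setP => v; rewrite inE E_spaceE; apply/andP/rowspanP.
  move=> [/rowspanP[x ->]]; rewrite -[x]hsubmxK mul_row_mt_basis row_mxKl.
  move/eqP; move/lin_indepP: (hY) => h /h ->; exists (lsubmx x).
  by rewrite mul_mx_row mulmx0 !mul0mx addr0.
move=> [x ->]; rewrite mul_mx_row mulmx0 row_mxKl eqxx; split=> //.
by apply/rowspanP; exists (row_mx x 0); rewrite mul_row_mt_basis !mul0mx addr0.
Qed.

(* A basis of P :&: E is X *m A with A a basis of P; reducing X to (1 0) by an
   invertible matrix completes it to a basis of P. *)
Lemma mt_subspace_basis P :
  P \in mt_subspaces R n k (t + s) t ->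
  exists Z Y X, [/\ lin_indep Z, lin_indep Y & P = rowspan (mt_basis Z Y X)].
Proof.
rewrite inE => /andP[/is_subspaceP[A hA PA] /is_subspaceP[B hB PE]].
have [|C BC] := @rowspan_subP _ _ _ _ B A; first by rewrite -PE -PA subsetIl.
have hC : lin_indep C by rewrite -(lin_indep_mull C hA) -BC.
have [_ [G invG]] := lin_indep_reduce hC; rewrite pid_mx_row => CG.
have [H GH HG] := invertible_mxP _ invG.
have hH : lin_indep H by rewrite lin_indep_invertible; apply: invertible_mx_right HG.
have hW : lin_indep (H *m A) by rewrite lin_indep_mull.
have PW : P = rowspan (H *m A) by rewrite rowspan_mull.
(* Since C = (1 0) H, the first t rows of [H *m A] are C A = B. *)
have BW : B = usubmx (H *m A).
  have -> : B = row_mx 1%:M 0 *m (H *m A).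
    by rewrite mulmxA -CG -(mulmxA C) GH mulmx1.
  by rewrite -{1}[H *m A]vsubmxK mul_row_col mul1mx mul0mx addr0.
move: (H *m A) hW PW BW => W hW PW BW.
have BE (x : 'rV_t) : lsubmx (x *m B) = 0.
  have : x *m B \in P :&: E_space R n k by rewrite PE; apply/rowspanP; exists x.
  by rewrite inE E_spaceE => /andP[_ /eqP].
have ulW : ulsubmx W = 0.
  rewrite /ulsubmx -BW; apply/row_matrixP => i.
  by rewrite row0 rowE mulmx_lsub BE.
have WE : W = mt_basis (ursubmx W) (dlsubmx W) (drsubmx W).
  by rewrite /mt_basis -ulW submxK.
have BE' : B = row_mx 0 (ursubmx W).
  by rewrite -[B]hsubmxK BW -ulW.
exists (ursubmx W), (dlsubmx W), (drsubmx W); rewrite -WE; split=> //.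
  apply/lin_indepP => x xZ; move/lin_indepP: hB; apply.
  by rewrite BE' mul_mx_row mulmx0 xZ row_mx0.
(* If x Y = 0, then (0 x) W lies in P and E, so it equals (y 0) W for some y; independence of [W]
   gives x = 0. *)
apply/lin_indepP => x xY.
have : row_mx 0 x *m W \in P :&: E_space R n k.
  rewrite inE E_spaceE PW; apply/andP; split; first by apply/rowspanP; eexists.
  by rewrite WE mul_row_mt_basis row_mxKl xY.
rewrite PE => /rowspanP[y eqy]; move/lin_indepP: hW => /(_ (row_mx (- y) x)).
have -> : row_mx (- y) x = row_mx 0 x - row_mx y 0.
  by rewrite opp_row_mx add_row_mx add0r oppr0 addr0.
rewrite mulmxBl eqy [in X in _ - X]WE mul_row_mt_basis !mul0mx addr0.
rewrite BE' mul_mx_row mulmx0 subrr => /(_ erefl)/eqP.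
by rewrite opp_row_mx add_row_mx row_mx_eq0 oppr0 addr0 => /andP[_ /eqP].
Qed.

(** The triples (Z, Y, X) with a given span form one free orbit of the invertible block matrices (G1
    0; G2 G3). *)
Lemma card_mt_subspaces_free :
  (#|free_mx R t k| * (#|free_mx R s n| * #|R| ^ (s * k)) =
   #|mt_subspaces R n k (t + s) t| *
     (#|free_mx R t t| * (#|free_mx R s s| * #|R| ^ (s * t))))%N.
Proof.
rewrite -!card_mx_set -!(cardsX (free_mx R s _)) -!(cardsX (free_mx R t _)).
apply: (@card_fibres _ _ (fun p => rowspan (mt_basis p.1 p.2.1 p.2.2))).
  move=> [Z [Y X]]; rewrite !inE /= => /and3P[hZ hY _].
  by have := mt_basis_mt_subspace X hZ hY; rewrite inE.
move=> P /mt_subspace_basis[Z [Y [X [hZ hY ->]]]].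
pose g (p : 'M[R]_t * ('M[R]_s * 'M[R]_(s, t))) :=
  (p.1 *m Z, (p.2.1 *m Y, p.2.2 *m Z + p.2.1 *m X)).
rewrite -(@card_in_imset _ _ g); last first.
  move=> [G1 [G3 G2]] [G1' [G3' G2']] _ _ [].
  move=> /(lin_indep_mulIr hZ) -> /(lin_indep_mulIr hY) ->.
  by move=> /addIr/(lin_indep_mulIr hZ) ->.
apply: eq_card => -[Z' [Y' X']]; apply/idP/imsetP => [|[[G1 [G3 G2]]]].
  rewrite !inE /= => /andP[/and3P[hZ' hY' _] /eqP eqW].
  have [|G] := @rowspan_subP _ _ _ _ (mt_basis Z' Y' X') (mt_basis Z Y X).
    by rewrite eqW.
  rewrite -[G]submxK /mt_basis mulmx_block !mulmx0 !add0r.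
  case/eq_block_mx => urY Z'E Y'E X'E.
  (* The zero block of the second basis equals this block times [Y], and [Y] cancels. *)
  have ur0 : ursubmx G = 0.
    by apply: (lin_indep_mulIr hY); rewrite -urY mul0mx.
  move: Z'E; rewrite ur0 mul0mx addr0 => Z'E.
  exists (ulsubmx G, (drsubmx G, dlsubmx G)); last by rewrite /g /= -Z'E -Y'E -X'E.
  rewrite !inE /= andbT -(lin_indep_mull _ hZ) -Z'E hZ'.
  by rewrite -(lin_indep_mull _ hY) -Y'E.
rewrite !inE /= => /and3P[hG1 hG3 _] [-> -> ->].
rewrite !lin_indep_mull // hG1 hG3 /=.
have -> : mt_basis (G1 *m Z) (G3 *m Y) (G2 *m Z + G3 *m X) =
    block_mx G1 0 G2 G3 *m mt_basis Z Y X.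
  by rewrite /mt_basis mulmx_block !mulmx0 !mul0mx ?addr0 ?add0r.
rewrite rowspan_mull // lin_indep_invertible.
by apply: invertible_block_lt; rewrite -lin_indep_invertible.
Qed.

Lemma mt_basis_act Z Y X (T11 : 'M[R]_n) T12 T22 :
  mt_basis Z Y X *m block_mx T11 T12 0 T22 =
  mt_basis (Z *m T22) (Y *m T11) (Y *m T12 + X *m T22).
Proof. by rewrite /mt_basis mulmx_block !mulmx0 !mul0mx ?addr0 ?add0r. Qed.

End NormalForm.

(** * The orbit and the nonemptiness condition *)

Lemma subspace_act_rowspan (R : finComNzRingType) m N (A : 'M[R]_(m, N)) T :
  subspace_act (rowspan A) T = rowspan (A *m T).
Proof.
apply/setP => v; apply/imsetP/rowspanP => [[_ /rowspanP[x ->] ->]|[x ->]].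
  by exists x; rewrite mulmxA.
by exists (x *m A); [apply/rowspanP; exists x | rewrite mulmxA].
Qed.

Lemma GL_blockP (R : finComNzRingType) n k (T : 'M[R]_(n + k)) :
  reflect (exists T11 T12 T22, [/\ invertible_mx T11, invertible_mx T22
             & T = block_mx T11 T12 0 T22]) (T \in GL_block R n k).
Proof.
rewrite inE; apply: (iffP andP) => [[_]|[T11 [T12 [T22 [h1 h2 ->]]]]].
  move=> /existsP[T11 /existsP[T12 /existsP[T22 /and3P[h1 h2 /eqP ->]]]].
  by exists T11, T12, T22.
split; first exact: invertible_block_ut.
by apply/existsP; exists T11; apply/existsP; exists T12; apply/existsP; exists T22;
  rewrite h1 h2 eqxx.
Qed.

Lemma lin_indep_transitive (R : finComNzRingType) m N (A B : 'M[R]_(m, N)) :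
  lin_indep A -> lin_indep B -> exists2 T, invertible_mx T & A *m T = B.
Proof.
move=> /lin_indep_reduce[_ [G invG AG]] /lin_indep_reduce[_ [H invH BH]].
have [H' HH' H'H] := invertible_mxP _ invH.
exists (G *m H'); first by apply: invertible_mxM => //; apply: invertible_mx_right H'H.
by rewrite mulmxA AG -BH -mulmxA HH' mulmx1.
Qed.

Lemma mt_subspaces_orbit (R : finComNzRingType) n k t s P :
  P \in mt_subspaces R n k (t + s) t ->
  mt_subspaces R n k (t + s) t = GL_orbit P.
Proof.
move=> /mt_subspace_basis[Z [Y [X [hZ hY ->]]]]; apply/setP => Q.
apply/idP/imsetP => [/mt_subspace_basis[Z' [Y' [X' [hZ' hY' ->]]]]|].
  have [T11 inv11 YT] := lin_indep_transitive hY hY'.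
  have [T22 inv22 ZT] := lin_indep_transitive hZ hZ'.
  have [C YC] := lin_indep_right_inverse hY.
  (* With Y C = 1, this upper right block T12 solves Y T12 + X T22 = X'. *)
  exists (block_mx T11 (C *m (X' - X *m T22)) 0 T22).
    by apply/GL_blockP; exists T11, (C *m (X' - X *m T22)), T22.
  by rewrite subspace_act_rowspan mt_basis_act YT ZT mulmxA YC mul1mx subrK.
move=> [T /GL_blockP[T11 [T12 [T22 [inv11 inv22 ->]]]] ->].
rewrite subspace_act_rowspan mt_basis_act.
by apply: mt_basis_mt_subspace; apply: lin_indep_mulr.
Qed.

(** A basis of the intersection is [C *m A] with [C] of size t x m; its rows are independent, so t
    cannot exceed m. *)
Lemma mt_subspace_le (R : finComNzRingType) n k m t P :
  P \in mt_subspaces R n k m t -> (t <= m)%N.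
Proof.
rewrite inE => /andP[/is_subspaceP[A hA PA] /is_subspaceP[B hB PE]].
have [|C BC] := @rowspan_subP _ _ _ _ B A; first by rewrite -PE -PA subsetIl.
by have [] := @lin_indep_reduce _ _ _ C; rewrite // -(lin_indep_mull C hA) -BC.
Qed.

Lemma lin_indep_pid (R : finComNzRingType) m N :
  (m <= N)%N -> lin_indep (pid_mx m : 'M[R]_(m, N)).
Proof.
move=> lemN; apply: (@unimodular_lin_indep _ _ _ _ (pid_mx m)).
by rewrite mul_pid_mx minnn (minn_idPr lemN) pid_mx_1.
Qed.

Lemma mt_subspaces_nonempty (R : finComNzRingType) n k m t :
  mt_subspaces R n k m t != set0 <-> [/\ (t <= k)%N, (t <= m)%N & (m - t <= n)%N].
Proof.
split=> [/set0Pn[P PP]|[letk letm]].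
  have letm := mt_subspace_le PP; move: PP; rewrite -{1}(subnKC letm).
  case/mt_subspace_basis=> Z [Y [X [/lin_indep_reduce[letk _]]]].
  by case/lin_indep_reduce.
rewrite -(subnKC letm) addKn; move: (m - t)%N => s les; apply/set0Pn; eexists.
by apply: (mt_basis_mt_subspace 0); apply: lin_indep_pid; [exact: letk | exact: les].
Qed.

(** * Independent rows over a product of local rings *)

(** If [x] is not a unit, x S is a proper ideal, contained in a maximal one, which must be [M]. *)
Lemma local_ring_unit (S : finComNzRingType) (M : {set S}) (x : S) :
  local_ring M -> x \notin M -> exists y, x * y = 1.
Proof.
move=> [_ uniqM] xM.
(* A boolean form of [idealr_closed], so that a maximal set can be extracted. *)
pose ideal (I : {set S}) := [&& 0 \in I, 1 \notin I &
  [forall a, forall u in I, forall v in I, a * u + v \in I]].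
have idealP (I : {set S}) : reflect (idealr_closed I) (ideal I).
  apply: (iffP and3P) => -[I0 I1 IM]; split=> //.
    by move=> a u v uI vI; move/forallP/(_ a)/forall_inP/(_ u uI)/forall_inP: IM; apply.
  by apply/forallP=> a; apply/forall_inP=> u uI; apply/forall_inP=> v; apply: IM.
have [/existsP[y /eqP xy]|/existsPn nox] := boolP [exists y, x * y == 1].
  by exists y.
have xI : ideal [set x * y | y in S].
  apply/idealP; split.
  - by apply/imsetP; exists 0; rewrite ?mulr0.
  - by apply/imsetP => -[y _ /esym/eqP]; apply/negP.
  move=> a _ _ /imsetP[y _ ->] /imsetP[z _ ->].
  by apply/imsetP; exists (a * y + z) => //; rewrite mulrDr mulrCA.
have [A /maxsetP[/idealP Aid maxA] sIA] := maxset_exists xI.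
case/negP: xM; rewrite -(uniqM A).
  by apply: (subsetP sIA); apply/imsetP; exists 1; rewrite ?mulr1.
by split=> // I /idealP Iid sAI; apply: maxA.
Qed.

(** If all entries fall in [M j], then v w = 1 puts 1 in [M j]. Conversely a unit entry in component
    j forces that component of an annihilator to vanish. *)
Lemma lin_indep_row_local_product (R : finComNzRingType) (l : nat)
    (S : 'I_l -> finComNzRingType) (M : forall j, {set S j})
    (proj : forall j, {rmorphism R -> S j}) (b : nat) (v : 'rV[R]_b) :
  (forall j, local_ring (M j)) -> is_ring_product proj ->
  lin_indep v = [forall j, exists i, proj j (v 0 i) \notin M j].
Proof.
move=> hlocal hprod; apply/idP/forallP => [/lin_indep_right_inverse[w vw] j|hv].
  apply/existsP; have [[[M0 M1 MM] _] _] := hlocal j.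
  case: (pickP (fun i => proj j (v 0 i) \notin M j)) => [i vi|vM]; first by exists i.
  case/negP: M1; rewrite -(rmorph1 (proj j)).
  have <- : (v *m w) 0 0 = 1 by rewrite vw mxE eqxx.
  rewrite mxE rmorph_sum /=; elim/big_rec: _ => // i x _ xM.
  rewrite rmorphM mulrC; apply: MM => //.
  by apply/negPn; rewrite vM.
apply/lin_indepP => x xv; rewrite [x]mx11_scalar; set z := x 0 0.
suff -> : z = 0 by rewrite raddf0.
have zv i : z * v 0 i = 0.
  by move/matrixP/(_ 0 i): xv; rewrite mxE big_ord1 [RHS]mxE.
apply: (bij_inj hprod); apply/ffunP => j; rewrite !ffunE rmorph0.
have /existsP[i /(local_ring_unit (hlocal j))[y viy]] := hv j.
by rewrite -[LHS]mulr1 -viy mulrA -rmorphM zv rmorph0 mul0r.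
Qed.

(** The map [h] splits a row into its components; [A j] holds the rows over [S j] with some entry
    outside [M j]. *)
Lemma card_free_row (R : finComNzRingType) (l : nat)
    (S : 'I_l -> finComNzRingType) (M : forall j, {set S j})
    (proj : forall j, {rmorphism R -> S j}) (b : nat) :
  (forall j, local_ring (M j)) -> is_ring_product proj ->
  #|free_mx R 1 b| = (\prod_(j < l) (#|S j| ^ b - #|M j| ^ b))%N.
Proof.
move=> hlocal hprod.
pose A j : {set {ffun 'I_b -> S j}} := ~: [set w | w \in ffun_on (M j)].
pose h (v : 'rV[R]_b) : {dffun forall j, {ffun 'I_b -> S j}} :=
  [ffun j => [ffun i => proj j (v 0 i)]].
have cardA j : #|A j| = (#|S j| ^ b - #|M j| ^ b)%N.
  by rewrite cardsCs setCK cardsE card_ffun_on card_ffun card_ord.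
under eq_bigr do rewrite -cardA.
rewrite -cardsXn -(@card_imset _ _ h); last first.
  move=> u v /ffunP eqh; apply/rowP => i; apply: (bij_inj hprod).
  apply/ffunP => j; move: (eqh j); rewrite !ffunE => /ffunP/(_ i).
  by rewrite !ffunE.
apply: eq_card => w; rewrite in_setXn.
have hA v : [forall j, h v j \in A j] = lin_indep v.
  rewrite (lin_indep_row_local_product _ hlocal hprod).
  apply: eq_forallb => j; rewrite !inE ffunE; apply/idP/existsP => [vM|[i vi]].
    apply/existsP; apply: contraNT vM => /existsPn vM.
    by apply/ffun_onP => i; rewrite ffunE; apply/negPn.
  by apply/negP => /ffun_onP/(_ i); rewrite ffunE (negbTE vi).
apply/imsetP/idP => [[v]|wA]; first by rewrite inE => hv ->; rewrite hA.
have [g _ gK] := hprod.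
pose v := \row_i g [ffun j => w j i].
have hv : h v = w.
  apply/ffunP => j; rewrite ffunE; apply/ffunP => i; rewrite ffunE mxE.
  by move/ffunP/(_ j): (gK [ffun j => w j i]); rewrite !ffunE.
by exists v => //; rewrite inE -hA hv.
Qed.

(** Both counts carry the factor |R|^i at row i; it cancels, leaving quotients of single-row
    counts. *)
Lemma subspace_countE (R : finComNzRingType) (l : nat)
    (S : 'I_l -> finComNzRingType) (M : forall j, {set S j})
    (proj : forall j, {rmorphism R -> S j}) (a b : nat) :
  (forall j, local_ring (M j)) -> is_ring_product proj ->
  subspace_count M a b = #|free_mx R a b|%:R / #|free_mx R a a|%:R.
Proof.
move=> hlocal hprod.
have rowE c : #|free_mx R 1 c|%:R =
    \prod_(j < l) (#|S j|%:R ^+ c - #|M j|%:R ^+ c) :> rat.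
  rewrite (card_free_row _ hlocal hprod) natr_prod; apply: eq_bigr => j _.
  (* The natural subtraction is exact because |M j|^c <= |S j|^c. *)
  by rewrite natrB ?natrX //; elim: c => // c IHc; rewrite !expnS leq_mul ?max_card.
rewrite !card_free_mx !natr_prod -prodf_div /subspace_count exchange_big /=.
apply: eq_bigr => i _; rewrite prodf_div -!rowE !natrM invfM mulrACA divff ?mul1r //.
by rewrite pnatr_eq0 -lt0n expn_gt0 (cardD1 0).
Qed.

Theorem theorem5p1 (R : finComNzRingType) (l : nat)
    (S : 'I_l -> finComNzRingType) (M : forall j, {set S j})
    (proj : forall j, {rmorphism R -> S j})
    (hlocal : forall j, local_ring (M j))
    (hprod : is_ring_product proj)
    (n k m t : nat) :
  [/\ mt_subspaces R n k m t != set0 <->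
        [/\ (t <= k)%N, (t <= m)%N & (m - t <= n)%N],
      mt_subspaces R n k m t != set0 ->
        (exists2 P, P \in mt_subspaces R n k m t &
                    mt_subspaces R n k m t = GL_orbit P) /\
        #|mt_subspaces R n k m t|%:R =
          #|R|%:R ^+ ((m - t) * (k - t))%N *
          subspace_count M (m - t) n * subspace_count M t k
    & forall a b : nat, #|subspaces R a b|%:R = subspace_count M a b].
Proof.
have free_neq0 a : #|free_mx R a a|%:R != 0 :> rat.
  by rewrite pnatr_eq0 -lt0n free_mx_square_gt0.
split; first exact: mt_subspaces_nonempty.
  move=> ne0; have [letk letm _] := (mt_subspaces_nonempty R n k m t).1 ne0.
  rewrite -{1 2 3 4}(subnKC letm) in ne0 *.
  move: (m - t)%N ne0 => s /set0Pn[P PP]; split.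
    by exists P => //; apply: mt_subspaces_orbit.
  have R0 : #|R|%:R != 0 :> rat by rewrite pnatr_eq0 -lt0n (cardD1 0).
  rewrite !(subspace_countE _ _ hlocal hprod).
  have /(congr1 (fun x => x%:R : rat)) := card_mt_subspaces_free R n k t s.
  (* As t <= k, the factor |R|^(s t) splits off and cancels against the fibre size, leaving |R|^(s
     (k - t)). *)
  have -> : (s * k = s * (k - t) + s * t)%N by rewrite -mulnDr subnK.
  rewrite expnD !natrM !natrX => card_eq.
  have d0 : #|free_mx R t t|%:R * (#|free_mx R s s|%:R * #|R|%:R ^+ (s * t)) != 0 :> rat.
    by rewrite !mulf_neq0 ?expf_neq0.
  apply: (mulIf d0); rewrite -card_eq.
  by field; rewrite ?free_neq0.
move=> a b; rewrite (subspace_countE _ _ hlocal hprod) card_subspaces_free natrM.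
by rewrite mulfK.
Qed.
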